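(* Let $K$ be a function field with full constant field $\mathbb{F}_q$ of characteristic $p\neq 3$, let $L/K$ be an impurely cubic extension, and let $y$ be a primitive element of $L/K$ with minimal polynomial $X^3-3X-a$, $a\in K$. Then the places $\mathfrak{p}$ of $K$ that are fully ramified in $L$ are precisely those with $v_{\mathfrak{p}}(a)<0$ and $\gcd(v_{\mathfrak{p}}(a),3)=1$.
   Context: $v_{\mathfrak{p}}$ is the normalized discrete valuation at the place $\mathfrak{p}$; fully ramified means some place above $\mathfrak{p}$ has ramification index $3$. For $p\neq 3$, a cubic extension is impurely cubic if it has no generator whose minimal polynomial is of the form $X^3-b$ with $b$ in the base field. *)

(* Defs.v *)
From HB Require Import structures.
From mathcomp Require Import all_boot all_order all_algebra all_field.
From mathcomp Require Import classical_sets.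

Set Implicit Arguments.
Unset Strict Implicit.
Unset Printing Implicit Defensive.

Import Order.TTheory GRing.Theory Num.Theory.
Local Open Scope ring_scope.
Local Open Scope classical_set_scope.

(* Function fields are infinite-dimensional over their constants, so the
   constants are given by a ring morphism iota : F -> K, as in algebraicOver,
   instead of a fieldExtType structure. *)

(* The subfield F(x) of K. *)
Definition ratfun_in (F K : fieldType) (iota : {rmorphism F -> K}) (x : K) :
    set K :=
  [set z | exists p q : {poly F},
    (map_poly iota q).[x] != 0 /\
    z = (map_poly iota p).[x] / (map_poly iota q).[x]].

(* Some x in K is transcendental over F, with K a finite extension of F(x). *)
Definition function_field (F K : fieldType) (iota : {rmorphism F -> K}) : Prop :=
  exists x : K, ~ algebraicOver iota x /\
  exists (n : nat) (b : 'I_n -> K), forall z : K,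
    exists c : 'I_n -> K,
      (forall i, ratfun_in iota x (c i)) /\ z = \sum_(i < n) c i * b i.

Definition full_constant_field (F K : fieldType) (iota : {rmorphism F -> K}) :
    Prop :=
  forall z : K, algebraicOver iota z -> exists c : F, z = iota c.

Definition valuation_ring (F K : fieldType) (iota : {rmorphism F -> K})
    (O : set K) : Prop :=
  [/\ (forall x y, O x -> O y -> O (x - y)) /\
      (forall x y, O x -> O y -> O (x * y)),
      range iota `<` O,
      O `<` setT
    & forall z : K, O z \/ O z^-1].

Definition ring_ideal (K : fieldType) (O I : set K) : Prop :=
  [/\ I `<=` O,
      I 0,
      forall x y, I x -> I y -> I (x + y)
    & forall r x, O r -> I x -> I (r * x)].

Definition maximal_ideal (K : fieldType) (O P : set K) : Prop :=
  [/\ ring_ideal O P,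
      P `<` O
    & forall I : set K, ring_ideal O I -> P `<=` I -> I `<` O -> I = P].

Definition is_place (F K : fieldType) (iota : {rmorphism F -> K}) (P : set K) :
    Prop :=
  exists2 O : set K, valuation_ring iota O & maximal_ideal O P.

(* v is the normalized discrete valuation at the place P.  Only the values of
   v on nonzero elements matter: v 0, which should be +oo, is left arbitrary. *)
Definition normalized_valuation (F K : fieldType) (iota : {rmorphism F -> K})
    (P : set K) (v : K -> int) : Prop :=
  [/\ forall x y : K, x != 0 -> y != 0 -> v (x * y) = v x + v y,
      forall x y : K, x != 0 -> y != 0 -> x + y != 0 ->
        Num.min (v x) (v y) <= v (x + y),
      exists2 x : K, x != 0 & v x = 1,
      forall c : F, c != 0 -> v (iota c) = 0
    & P = [set x | x = 0 \/ 0 < v x]].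

Section Extension.
Variables (F K : fieldType) (iota : {rmorphism F -> K}) (L : fieldExtType K).

(* L viewed over the constants F of K; F may be smaller than the full constant
   field of L, which does not change the places of L. *)
Definition ext_constants : {rmorphism F -> L} := in_alg L \o iota.

Definition lies_above (P' : set L) (P : set K) : Prop :=
  [set x%:A | x in P] `<=` P'.

Definition ramification_index (P' : set L) (P : set K) (e : nat) : Prop :=
  exists (v : K -> int) (v' : L -> int),
    [/\ normalized_valuation iota P v,
        normalized_valuation ext_constants P' v'
      & forall x : K, x != 0 -> v' x%:A = e%:Z * v x].

Definition fully_ramified (P : set K) : Prop :=
  exists P' : set L,
    [/\ is_place ext_constants P', lies_above P' P & ramification_index P' P 3%N].

End Extension.

Definition primitive_element (K : fieldType) (L : fieldExtType K) (y : L) :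
    Prop :=
  <<1; y>>%VS = {:L}%VS.

Definition impurely_cubic (K : fieldType) (L : fieldExtType K) : Prop :=
  \dim {:L} = 3%N /\
  ~ exists (z : L) (b : K),
      primitive_element z /\ minPoly 1 z = 'X^3 - (b%:A)%:P.

(* Main.v *)
Require Import Defs.
From HB Require Import structures.
From mathcomp Require Import all_boot all_order all_algebra all_field.
From mathcomp Require Import classical_sets.
From mathcomp Require Import ring zify.

Set Implicit Arguments.
Unset Strict Implicit.
Unset Printing Implicit Defensive.

Import Order.TTheory GRing.Theory Num.Theory.
Local Open Scope ring_scope.

(* If 3 does not divide v a < 0, the place is explicit: u |-> v (N u), with N
   the norm to K, is min (3 v c_i + i v a) at u = c_0 + c_1 y + c_2 y^2, because
   the three values are distinct mod 3 and all the mixed terms of N have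
   valuation strictly above the least of them. So v o N is a valuation of L.

   Conversely, if v' has ramification index 3 over v and v' t = 1, then
   1, t, t^2 is a K-basis of L, so y = c_0 + z with c_0 in K and r = v' z prime
   to 3. Expanding the cubic equation of y gives
     z^3 + 3 c_0 z^2 + 3 (c_0^2 - 1) z = a - (c_0^3 - 3 c_0),
   whose right-hand side has valuation divisible by 3, or is 0. Hence z^3
   has strictly smaller valuation than the two other terms on the left:
   3 v c_0 > r and 3 v (c_0^2 - 1) > 2 r.
   If r > 0, then 1 = c_0^2 - (c_0^2 - 1) would have positive valuation. So
   r < 0, whence v' y = r, v' a = 3 r and v a = r. *)

(** * Integer-valued valuations on a field *)

Definition int_valuation (K : fieldType) (v : K -> int) : Prop :=
  (forall x y : K, x != 0 -> y != 0 -> v (x * y) = v x + v y) /\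
  (forall x y : K, x != 0 -> y != 0 -> x + y != 0 ->
     Num.min (v x) (v y) <= v (x + y)).

Lemma normalized_int_valuation (F K : fieldType) (iota : {rmorphism F -> K})
    (P : set K) (v : K -> int) :
  normalized_valuation iota P v -> int_valuation v.
Proof. by case=> vM vD _ _ _; split. Qed.

(* v x >= n with the convention v 0 = +oo, whatever the junk value at 0. *)
Definition val_ge (K : fieldType) (v : K -> int) (n : int) (x : K) : Prop :=
  x = 0 \/ n <= v x.

Section IntValuation.
Variables (K : fieldType) (v : K -> int).
Hypothesis hv : int_valuation v.

Lemma valuationM (x y : K) : x != 0 -> y != 0 -> v (x * y) = v x + v y.
Proof. by case: hv => vM _; exact: vM. Qed.

Lemma valuation1 : v 1 = 0.
Proof.
have : v (1 * 1) = v 1 + v 1 by rewrite valuationM ?oner_neq0.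
by rewrite mulr1; lia.
Qed.

Lemma valuationN (x : K) : x != 0 -> v (- x) = v x.
Proof.
move=> x0; have n10 : (-1 : K) != 0 by rewrite oppr_eq0 oner_neq0.
have := valuationM n10 n10; rewrite mulrNN mulr1 valuation1 => e.
by rewrite -mulN1r valuationM //; lia.
Qed.

Lemma valuationV (x : K) : x != 0 -> v x^-1 = - v x.
Proof.
move=> x0; have xV0 : x^-1 != 0 by rewrite invr_eq0.
by have := valuationM x0 xV0; rewrite divff // valuation1; lia.
Qed.

Lemma valuationX (x : K) (n : nat) : x != 0 -> v (x ^+ n) = n%:Z * v x.
Proof.
move=> x0; elim: n => [|n IHn]; first by rewrite expr0 valuation1 mul0r.
by rewrite exprS valuationM ?expf_neq0 // IHn; lia.
Qed.

Lemma valuationXz (x : K) (n : int) : x != 0 -> v (x ^ n) = n * v x.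
Proof.
move=> x0; case: n => n; first by rewrite -exprnP valuationX.
by rewrite NegzE -exprnN valuationV ?expf_neq0 // valuationX //; lia.
Qed.

Lemma val_ge_refl (x : K) : val_ge v (v x) x.
Proof. by right. Qed.

Lemma val_ge_trans (m n : int) (x : K) : n <= m -> val_ge v m x -> val_ge v n x.
Proof. by move=> nm [->|mx]; [left | right; exact: le_trans nm mx]. Qed.

(** The monotone [g] covers the functions [3 * k + i * v a] that weight the coordinates of an
    element in the valuation of its norm. *)
Lemma val_ge_homoD (g : int -> int) (n : int) (x y : K) :
  {homo g : i j / i <= j} ->
  val_ge (g \o v) n x -> val_ge (g \o v) n y -> val_ge (g \o v) n (x + y).
Proof.
move=> g_homo; case: (eqVneq x 0) => [->|x0]; first by rewrite add0r.
case: (eqVneq y 0) => [->|y0]; first by rewrite addr0.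
case=> [x0'|nx]; first by rewrite x0' eqxx in x0.
case=> [y0'|ny]; first by rewrite y0' eqxx in y0.
case: (eqVneq (x + y) 0) => [|xy0]; [by left | right].
case: hv => _ vD; move: (vD _ _ x0 y0 xy0); rewrite ge_min.
by case/orP=> /g_homo; apply: le_trans.
Qed.

Lemma val_geD (n : int) (x y : K) :
  val_ge v n x -> val_ge v n y -> val_ge v n (x + y).
Proof. by apply: (@val_ge_homoD id). Qed.

Lemma val_geN (n : int) (x : K) : val_ge v n x -> val_ge v n (- x).
Proof.
case: (eqVneq x 0) => [->|x0]; first by rewrite oppr0.
by case=> [x0'|nx]; [rewrite x0' eqxx in x0 | right; rewrite valuationN].
Qed.

Lemma val_geM (m n : int) (x y : K) :
  val_ge v m x -> val_ge v n y -> val_ge v (m + n) (x * y).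
Proof.
case: (eqVneq x 0) => [->|x0]; first by left; rewrite mul0r.
case: (eqVneq y 0) => [->|y0]; first by left; rewrite mulr0.
case=> [x0'|nx]; first by rewrite x0' eqxx in x0.
case=> [y0'|ny]; first by rewrite y0' eqxx in y0.
by right; rewrite valuationM // lerD.
Qed.

Lemma val_geX (m : int) (x : K) (n : nat) :
  val_ge v m x -> val_ge v (n%:Z * m) (x ^+ n).
Proof.
move=> mx; elim: n => [|n IHn]; first by right; rewrite mul0r expr0 valuation1.
rewrite exprS; apply: val_ge_trans (val_geM mx IHn); lia.
Qed.

(** Writing [x] as [(x + y) - y] bounds [v x] below by the minimum of [v (x + y)] and [v y], and
    [v y] exceeds [v x]. The condition on [y] also admits [y = 0]. *)
Lemma val_dominant (x y : K) :
  x != 0 -> val_ge v (v x + 1) y -> x + y != 0 /\ v (x + y) = v x.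
Proof.
move=> x0; case: (eqVneq y 0) => [-> _|y0]; first by rewrite addr0.
case=> [y0'|xy]; first by rewrite y0' eqxx in y0.
have xy0 : x + y != 0.
  apply/eqP=> /(canRL (addKr _)); rewrite addr0 => yE.
  by move: xy; rewrite yE valuationN //; lia.
split=> //; have [_ vD] := hv.
have h1 := vD _ _ x0 y0 xy0.
have : Num.min (v (x + y)) (v (- y)) <= v x.
  by rewrite -{2}(addrK y x); apply: vD; rewrite ?oppr_eq0 ?addrK.
rewrite valuationN // ge_min; case/orP; last by lia.
by move: h1; rewrite ge_min; case/orP; lia.
Qed.

Lemma val_neq_add (x y : K) : x != 0 -> y != 0 -> v x != v y ->
  x + y != 0 /\ (v (x + y) = v x \/ v (x + y) = v y).
Proof.
move=> x0 y0; case: (ltgtP (v x) (v y)) => // vxy _.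
  by have [] := @val_dominant x y x0; [right; lia | split=> //; left].
have [] := @val_dominant y x y0; first by right; lia.
by rewrite addrC; split=> //; right.
Qed.

End IntValuation.

(** * Places and normalized valuations *)

Section Normalized.
Variables (F K : fieldType) (iota : {rmorphism F -> K}).
Local Open Scope classical_set_scope.

Lemma val_ge_const (P : set K) (v : K -> int) (c : F) :
  normalized_valuation iota P v -> val_ge v 0 (iota c).
Proof.
case=> _ _ _ vc _; case: (eqVneq c 0) => [->|c0].
  by left; rewrite rmorph0.
by right; rewrite vc.
Qed.

Lemma normalized_valuation_place (P : set K) (v : K -> int) :
  normalized_valuation iota P v -> is_place iota P.
Proof.
move=> nv; have hv := normalized_int_valuation nv.
case: (nv) => _ _ [t t0 vt] vc PE.
have tV0 : t^-1 != 0 by rewrite invr_eq0.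
exists (val_ge v 0).
  split.
  - split=> x y xO yO; last by have := val_geM hv xO yO; rewrite addr0.
    by apply: val_geD => //; exact: val_geN.
  - split=> [_ [c _ <-]|]; first exact: val_ge_const nv.
    (* A uniformizer is not a constant, since nonzero constants have valuation 0. *)
    move=> /(_ t); case; first by right; rewrite vt.
    move=> c _ ct; move: t0 vt; rewrite -ct fmorph_eq0 => c0.
    by rewrite vc.
  - split=> // /(_ t^-1 I); case=> [/eqP|]; first by rewrite (negbTE tV0).
    by rewrite (valuationV hv) // vt.
  - move=> z; case: (eqVneq z 0) => [->|z0]; first by left; left.
    case: (leP 0 (v z)) => vz; [by left; right | right; right].
    by rewrite (valuationV hv) //; lia.
have P_ge x : P x <-> val_ge v 1 x.
  by rewrite PE; split=> -[|vx]; [left | right; lia | left | right; lia].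
split.
- split=> [x /P_ge|||].
  + by apply: val_ge_trans.
  + by apply/P_ge; left.
  + by move=> x y /P_ge xP /P_ge yP; apply/P_ge; exact: val_geD.
  + move=> r x rO /P_ge xP; apply/P_ge.
    by have := val_geM hv rO xP; rewrite add0r.
- split=> [x /P_ge|]; first by apply: val_ge_trans.
  move=> /(_ 1); case/(_ _)/P_ge; first by right; rewrite (valuation1 hv).
    by move/eqP; rewrite oner_eq0.
  by rewrite (valuation1 hv).
(* An element of valuation 0 is a unit of the ring, so a proper ideal contains none and stays inside
   [P]. *)
- move=> I [IO I0 ID IM] PI [_ OI]; apply/seteqP; split=> // x xI.
  apply/P_ge; case: (eqVneq x 0) => [->|x0]; first by left.
  case: (IO _ xI) => [|vx]; first by left.
  case: (eqVneq (v x) 0) => [vx0|vx0]; last by right; lia.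
  case: OI => z zO; rewrite -(mulfVK x0 z); apply: IM => //.
  have xVO : val_ge v 0 x^-1 by right; rewrite (valuationV hv) // vx0.
  by have := val_geM hv zO xVO; rewrite addr0.
Qed.

(** [P] determines where a valuation is positive, hence where it vanishes. As [x * t ^ (- v x)] has
    [v]-value 0, it has [w]-value 0, so [w x = v x * w t]; evaluating at [s] with [w s = 1] forces
    [w t = 1]. *)
Lemma normalized_valuation_unique (P : set K) (v w : K -> int) :
  normalized_valuation iota P v -> normalized_valuation iota P w ->
  forall x, x != 0 -> v x = w x.
Proof.
move=> nv nw; have hv := normalized_int_valuation nv.
have hw := normalized_int_valuation nw.
have [_ _ [t t0 vt] _ PE] := nv.
have [_ _ [s s0 ws] _ QE] := nw.
have pos x : x != 0 -> (0 < v x) = (0 < w x).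
  move=> x0; have : P x <-> P x by [].
  rewrite {1}PE QE /= => -[h1 h2]; apply/idP/idP => h.
    by case: h1 => [|/eqP|//]; [right | rewrite (negbTE x0)].
  by case: h2 => [|/eqP|//]; [right | rewrite (negbTE x0)].
have zero x : x != 0 -> v x = 0 -> w x = 0.
  move=> x0 vx; have := pos _ x0; have xV0 : x^-1 != 0 by rewrite invr_eq0.
  by have := pos _ xV0; rewrite (valuationV hv) // (valuationV hw) // vx; lia.
have lin x : x != 0 -> w x = v x * w t.
  move=> x0; have tn0 : t ^ (- v x) != 0 by rewrite expfz_neq0.
  have := zero (x * t ^ (- v x)).
  rewrite (valuationM hv) // (valuationM hw) // (valuationXz hv) //.
  rewrite (valuationXz hw) // mulf_neq0 // vt.
  by rewrite mulr1 subrr mulNr => /(_ isT erefl) /eqP; rewrite subr_eq0 => /eqP.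
have wt : 0 < w t by rewrite -pos // vt.
have ws1 := lin _ s0; rewrite ws in ws1.
have vs : 0 < v s by rewrite pos // ws.
have wt1 : w t = 1 by nia.
by move=> x x0; rewrite lin // wt1 mulr1.
Qed.

End Normalized.

(** * The norm form of the cubic and its valuation *)

(* The norm to R of c0 + c1 y + c2 y^2, where y^3 = 3 y + a. *)
Definition cubic_norm (R : comNzRingType) (a c0 c1 c2 : R) : R :=
  c0 ^+ 3 + a * c1 ^+ 3 + a ^+ 2 * c2 ^+ 3
  - 3%:R * c0 * c1 ^+ 2 + 6%:R * c0 ^+ 2 * c2 + 9%:R * c0 * c2 ^+ 2
  - 3%:R * a * c1 * c2 ^+ 2 - 3%:R * a * c0 * c1 * c2.

(** Multiplicativity of the norm: the arguments on the left are the coordinates of the product, as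
    computed in [cubic_mulE]. *)
Lemma cubic_normM (R : comNzRingType) (a u0 u1 u2 w0 w1 w2 : R) :
  cubic_norm a (u0 * w0 + a * (u1 * w2 + u2 * w1))
    (u0 * w1 + u1 * w0 + 3%:R * (u1 * w2 + u2 * w1) + a * (u2 * w2))
    (u0 * w2 + u1 * w1 + u2 * w0 + 3%:R * (u2 * w2)) =
  cubic_norm a u0 u1 u2 * cubic_norm a w0 w1 w2.
Proof. by rewrite /cubic_norm; ring. Qed.

Lemma cubic_mulE (R : comNzRingType) (y a u0 u1 u2 w0 w1 w2 : R) :
  y ^+ 3 = 3%:R * y + a ->
  (u0 + u1 * y + u2 * y ^+ 2) * (w0 + w1 * y + w2 * y ^+ 2) =
  (u0 * w0 + a * (u1 * w2 + u2 * w1))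
  + (u0 * w1 + u1 * w0 + 3%:R * (u1 * w2 + u2 * w1) + a * (u2 * w2)) * y
  + (u0 * w2 + u1 * w1 + u2 * w0 + 3%:R * (u2 * w2)) * y ^+ 2.
Proof.
(* Eliminating [a] leaves a polynomial identity in [y] and the coordinates. *)
move=> yE; have -> : a = y ^+ 3 - 3%:R * y by rewrite yE addrAC subrr add0r.
by ring.
Qed.

Section CubicNormVal.
Variables (K : fieldType) (v : K -> int).
Hypothesis hv : int_valuation v.
Hypothesis v_nat : forall n : nat, val_ge v 0 n%:R.

(* With N large, a zero coefficient never attains a minimum of valuations. *)
Lemma val_lower_bound (N : int) (c : K) :
  exists k, val_ge v k c /\ ((c = 0 /\ N <= k) \/ (c != 0 /\ k = v c)).
Proof.
case: (eqVneq c 0) => [->|c0]; first by exists N; split; left.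
by exists (v c); split; [exact: val_ge_refl | right].
Qed.

(** The least of the three weights is described through its lower bounds [n]: zero coordinates then
    need no value, and the ultrametric inequality for the norm can be checked coordinate by
    coordinate. *)
Lemma val_cubic_norm (a c0 c1 c2 : K) :
  a != 0 -> v a < 0 -> ~~ (3 %| v a)%Z ->
  [|| c0 != 0, c1 != 0 | c2 != 0] ->
  cubic_norm a c0 c1 c2 != 0 /\
  forall n, n <= v (cubic_norm a c0 c1 c2) <->
    [/\ val_ge (fun x => 3 * v x) n c0,
        val_ge (fun x => 3 * v x + v a) n c1 &
        val_ge (fun x => 3 * v x + 2 * v a) n c2].
Proof.
move=> a0 va nva c_neq0.
pose N := `|v c0| + `|v c1| + `|v c2| + `|v a|.
have [k0 [g0 h0]] := val_lower_bound N c0.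
have [k1 [g1 h1]] := val_lower_bound N c1.
have [k2 [g2 h2]] := val_lower_bound N c2.
have ga := val_ge_refl v a.
have g01 := val_geM hv (val_geM hv (v_nat 3) g0) (val_geX hv 2 g1).
have g02 := val_geM hv (val_geM hv (v_nat 6) (val_geX hv 2 g0)) g2.
have g03 := val_geM hv (val_geM hv (v_nat 9) g0) (val_geX hv 2 g2).
have g3a := val_geM hv (v_nat 3) ga.
have g12 := val_geM hv (val_geM hv g3a g1) (val_geX hv 2 g2).
have g012 := val_geM hv (val_geM hv (val_geM hv g3a g0) g1) g2.
have f0 := val_geX hv 3 g0.
have f1 := val_geM hv ga (val_geX hv 3 g1).
have f2 := val_geM hv (val_geX hv 2 ga) (val_geX hv 3 g2).
have [M [M0 M1 M2] Mk] : exists2 M,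
    [/\ M <= 3 * k0, M <= 3 * k1 + v a & M <= 3 * k2 + 2 * v a] &
    [\/ M = 3 * k0, M = 3 * k1 + v a | M = 3 * k2 + 2 * v a].
  case: (leP (3 * k0) (3 * k1 + v a)) => l01.
    case: (leP (3 * k0) (3 * k2 + 2 * v a)) => l02.
      by exists (3 * k0); [split; lia | constructor 1].
    by exists (3 * k2 + 2 * v a); [split; lia | constructor 3].
  case: (leP (3 * k1 + v a) (3 * k2 + 2 * v a)) => l12.
    by exists (3 * k1 + v a); [split; lia | constructor 2].
  by exists (3 * k2 + 2 * v a); [split; lia | constructor 3].
(* By the choice of [N], a nonzero coordinate has weight below [3 * N + 2 * v a], while a zero one
   is assigned at least that much. So [M] is attained only at nonzero coordinates. *)
have M_lt : M < 3 * N + 2 * v a.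
  have Nv : [/\ v c0 <= N + v a, v c1 <= N + v a & v c2 <= N + v a].
    by rewrite /N; split; lia.
  case: Nv => Nv0 Nv1 Nv2; case/or3P: c_neq0 => ci.
  - by case: h0 => -[c0E ?]; [rewrite c0E eqxx in ci | lia].
  - by case: h1 => -[c1E ?]; [rewrite c1E eqxx in ci | lia].
  - by case: h2 => -[c2E ?]; [rewrite c2E eqxx in ci | lia].
(* The weights are congruent to [0], [r] and [2 * r] mod 3, hence pairwise distinct. *)
have [s [r [vaE r12]]] : exists s r : int, v a = 3 * s + r /\ (r = 1 \/ r = 2).
  exists (v a %/ 3)%Z; exists (v a %% 3)%Z; lia.
suff [N0 vN Mc] : [/\ cubic_norm a c0 c1 c2 != 0,
    v (cubic_norm a c0 c1 c2) = M &
    [\/ c0 != 0 /\ M = 3 * v c0, c1 != 0 /\ M = 3 * v c1 + v a |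
        c2 != 0 /\ M = 3 * v c2 + 2 * v a]].
  split=> // n; rewrite vN; split=> [nM|[n0 n1 n2]].
    split.
    - by case: h0 => -[? ?]; [left | right; lia].
    - by case: h1 => -[? ?]; [left | right; lia].
    - by case: h2 => -[? ?]; [left | right; lia].
  case: Mc => -[/eqP ci ->].
  - by case: n0.
  - by case: n1.
  - by case: n2.
pose cross := - (3%:R * c0 * c1 ^+ 2) + 6%:R * c0 ^+ 2 * c2
  + 9%:R * c0 * c2 ^+ 2 - 3%:R * a * c1 * c2 ^+ 2 - 3%:R * a * c0 * c1 * c2.
(* Three times the bound on each of the first four terms is a sum of three weights plus a positive
   multiple of [- v a], hence above [3 * M]. For the last term it is the sum of the three weights,
   which are distinct and at least [M]. *)
have cross_ge : val_ge v (M + 1) cross.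
  rewrite /cross; repeat apply: (val_geD hv) => //;
    try apply: (val_geN hv) => //.
  - by apply: val_ge_trans g01; lia.
  - by apply: val_ge_trans g02; lia.
  - by apply: val_ge_trans g03; lia.
  - by apply: val_ge_trans g12; lia.
  - by apply: val_ge_trans g012; lia.
(* Whichever pure term attains [M], the other two lie strictly above it, so it dominates the
   norm. *)
case: Mk => Mk.
- case: h0 => -[c0n k0E]; first by lia.
  have -> : cubic_norm a c0 c1 c2 =
      c0 ^+ 3 + (a * c1 ^+ 3 + (a ^+ 2 * c2 ^+ 3 + cross)).
    by rewrite /cubic_norm /cross; ring.
  have lead0 : c0 ^+ 3 != 0 by rewrite expf_neq0.
  have vlead : v (c0 ^+ 3) = M by rewrite (valuationX hv) // -k0E Mk.
  have [|nz ->] := val_dominant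
      (y := a * c1 ^+ 3 + (a ^+ 2 * c2 ^+ 3 + cross)) hv lead0.
    rewrite vlead; repeat apply: (val_geD hv) => //.
    + by apply: val_ge_trans f1; lia.
    + by apply: val_ge_trans f2; lia.
  by split=> //; constructor 1; rewrite -k0E.
- case: h1 => -[c1n k1E]; first by lia.
  have -> : cubic_norm a c0 c1 c2 =
      a * c1 ^+ 3 + (c0 ^+ 3 + (a ^+ 2 * c2 ^+ 3 + cross)).
    by rewrite /cubic_norm /cross; ring.
  have lead0 : a * c1 ^+ 3 != 0 by rewrite mulf_neq0 ?expf_neq0.
  have vlead : v (a * c1 ^+ 3) = M.
    by rewrite (valuationM hv) ?expf_neq0 // (valuationX hv) // -k1E; lia.
  have [|nz ->] := val_dominant
      (y := c0 ^+ 3 + (a ^+ 2 * c2 ^+ 3 + cross)) hv lead0.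
    rewrite vlead; repeat apply: (val_geD hv) => //.
    + by apply: val_ge_trans f0; lia.
    + by apply: val_ge_trans f2; lia.
  by split=> //; constructor 2; rewrite -k1E.
- case: h2 => -[c2n k2E]; first by lia.
  have -> : cubic_norm a c0 c1 c2 =
      a ^+ 2 * c2 ^+ 3 + (c0 ^+ 3 + (a * c1 ^+ 3 + cross)).
    by rewrite /cubic_norm /cross; ring.
  have lead0 : a ^+ 2 * c2 ^+ 3 != 0 by rewrite mulf_neq0 ?expf_neq0.
  have vlead : v (a ^+ 2 * c2 ^+ 3) = M.
    by rewrite (valuationM hv) ?expf_neq0 // !(valuationX hv) // -k2E; lia.
  have [|nz ->] := val_dominant (y := c0 ^+ 3 + (a * c1 ^+ 3 + cross)) hv lead0.
    rewrite vlead; repeat apply: (val_geD hv) => //.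
    + by apply: val_ge_trans f0; lia.
    + by apply: val_ge_trans f1; lia.
  by split=> //; constructor 3; rewrite -k2E.
Qed.

End CubicNormVal.

(** * Coordinates in a cubic extension and the ramified place *)

Section CubicExtension.
Variables (K : fieldType) (L : fieldExtType K).

(** Linear independence of [1], [t], [t ^+ 2] over [K], spelled out with scalars; it serves both for
    the generator [y] and for a uniformizer of [L]. *)
Definition powers_free (t : L) : Prop := forall c0 c1 c2 : K,
  c0%:A + c1%:A * t + c2%:A * t ^+ 2 = 0 -> [/\ c0 = 0, c1 = 0 & c2 = 0].

Lemma powers_free_eq (t : L) (c0 c1 c2 d0 d1 d2 : K) : powers_free t ->
  c0%:A + c1%:A * t + c2%:A * t ^+ 2 = d0%:A + d1%:A * t + d2%:A * t ^+ 2 ->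
  [/\ c0 = d0, c1 = d1 & c2 = d2].
Proof.
move=> tfree e.
have [|/eqP e0 /eqP e1 /eqP e2] := tfree (c0 - d0) (c1 - d1) (c2 - d2).
  rewrite !scalerBl -(subrr (c0%:A + c1%:A * t + c2%:A * t ^+ 2)) {2}e.
  by ring.
by split; apply/eqP; rewrite -subr_eq0.
Qed.

(** Three independent vectors in dimension 3 form a basis. The coordinates come as one function,
    from which the norm can be defined. *)
Lemma powers_free_coords (t : L) : \dim {:L} = 3%N -> powers_free t ->
  exists c : L -> K * K * K, forall u,
    u = (c u).1.1%:A + (c u).1.2%:A * t + (c u).2%:A * t ^+ 2.
Proof.
move=> dimL tfree; pose X := [tuple 1; t; t ^+ 2].
have Xfree : free X.
  apply/freeP => k; rewrite !big_ord_recl big_ord0 /= addr0 addrA => e.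
  have [] := tfree (k ord0) (k (lift ord0 ord0))
    (k (lift ord0 (lift ord0 ord0))).
    by rewrite -e !mulr_algl.
  move=> e0 e1 e2 [[|[|[|//]]] i].
  - by rewrite -e0; congr k; apply: val_inj.
  - by rewrite -e1; congr k; apply: val_inj.
  - by rewrite -e2; congr k; apply: val_inj.
have Xbasis : basis_of {:L} X by rewrite basisEfree Xfree subvf dimL.
exists (fun u => (coord X ord0 u, coord X (lift ord0 ord0) u,
                  coord X (lift ord0 (lift ord0 ord0)) u)) => u /=.
rewrite {1}(coord_basis Xbasis (memvf u)) !big_ord_recl big_ord0 /= addr0 addrA.
by rewrite !mulr_algl.
Qed.

(** A relation gives a polynomial of degree at most 2 divisible by the minimal polynomial, of degree
    3, so it is zero. *)
Lemma minPoly_powers_free (t : L) : size (minPoly 1 t) = 4%N -> powers_free t.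
Proof.
move=> szt c0 c1 c2 e.
pose q : {poly K} := c0%:P + c1 *: 'X + c2 *: 'X^2.
have q0 : map_poly (in_alg L) q = 0.
  apply/eqP/negPn/negP => qn0.
  have : (minPoly 1 t %| map_poly (in_alg L) q)%R.
    apply: minPoly_dvdp; first exact: alg_polyOver.
    rewrite /root -e /q !rmorphD /= !map_polyZ map_polyC map_polyX map_polyXn.
    by rewrite !hornerE.
  move/(dvdp_leq qn0); rewrite szt size_map_poly leqNgt => /negP[].
  rewrite ltnS (leq_trans (size_polyD _ _)) // geq_max.
  rewrite (leq_trans (size_polyD _ _)) ?geq_max;
    rewrite ?(leq_trans (size_scale_leq _ _)) //.
  - by rewrite size_polyXn.
  - by rewrite andbT (leq_trans (size_polyC_leq1 _)).
  - by rewrite size_polyX.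
move/eqP: q0; rewrite map_poly_eq0 => /eqP q0.
have qc i : q`_i = 0 by rewrite q0 coef0.
split; [rewrite -(qc 0%N) | rewrite -(qc 1%N) | rewrite -(qc 2%N)];
  by rewrite /q !coefE /= ?(mulr0, mulr1, addr0, add0r).
Qed.

Variables (F : fieldType) (iota : {rmorphism F -> K}).
Local Open Scope classical_set_scope.

Lemma fully_ramified_of_val (P : set K) (v : K -> int) (a : K) (y : L) :
  normalized_valuation iota P v ->
  \dim {:L} = 3%N -> powers_free y -> y ^+ 3 = 3%:R * y + a%:A ->
  a != 0 -> v a < 0 -> ~~ (3 %| v a)%Z -> fully_ramified iota L P.
Proof.
move=> nv dimL yfree yE a0 va nva.
have hv := normalized_int_valuation nv.
have v_nat n : val_ge v 0 n%:R.
  by rewrite -(rmorph_nat iota); exact: val_ge_const nv.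
have [c cE] := powers_free_coords dimL yfree.
pose N u := cubic_norm a (c u).1.1 (c u).1.2 (c u).2.
pose v' u := v (N u).
have cK c0 c1 c2 : c (c0%:A + c1%:A * y + c2%:A * y ^+ 2) = (c0, c1, c2).
  have := cE (c0%:A + c1%:A * y + c2%:A * y ^+ 2).
  case: (c _) => -[d0 d1] d2 /= /(powers_free_eq yfree).
  by case=> -> -> ->.
have cM u w : N (u * w) = N u * N w.
  have uwE := cubic_mulE (c u).1.1%:A (c u).1.2%:A (c u).2%:A
    (c w).1.1%:A (c w).1.2%:A (c w).2%:A yE.
  rewrite -!cE in uwE.
  have AM k l : (k * l)%:A = k%:A * l%:A :> L by rewrite mulr_algl scalerA.
  have A3 : 3%:R%:A = 3%:R :> L by rewrite scaler_nat.
  rewrite -A3 -!(AM, scalerDl) in uwE.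
  by rewrite /N uwE cK /= cubic_normM.
have c_neq0 u : u != 0 -> [|| (c u).1.1 != 0, (c u).1.2 != 0 | (c u).2 != 0].
  move=> u0; rewrite -!negb_and.
  apply: contra u0 => /and3P[/eqP e0 /eqP e1 /eqP e2].
  by rewrite (cE u) e0 e1 e2 !scale0r !mul0r !addr0.
have NP u (u0 : u != 0) := val_cubic_norm hv v_nat a0 va nva (c_neq0 u u0).
(* On [K] the norm is the cube; this is where ramification index 3 comes from. *)
have v'K x : x != 0 -> v' x%:A = 3%:Z * v x.
  move=> x0; have -> : x%:A = x%:A + 0%:A * y + 0%:A * y ^+ 2 :> L.
    by rewrite scale0r !mul0r !addr0.
  rewrite /v' /N cK /= -(valuationX hv) //; congr v; rewrite /cubic_norm.
  by ring.
have hv' : int_valuation v'.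
  split=> [x y' x0 y0|x y' x0 y0 xy0].
    by rewrite /v' cM (valuationM hv) //; case: (NP _ x0) (NP _ y0) => ? _ [].
  have cD : c (x + y') = ((c x).1.1 + (c y').1.1, (c x).1.2 + (c y').1.2,
                          (c x).2 + (c y').2).
    rewrite -cK {1}(cE x) {1}(cE y'); congr c; rewrite !scalerDl; ring.
  have [_ Dx] := NP _ x0; have [_ Dy] := NP _ y0; have [_ Dxy] := NP _ xy0.
  rewrite /v' /N; apply/Dxy; rewrite cD /=.
  have /Dx[x_0 x_1 x_2] : Num.min (v' x) (v' y') <= v' x by rewrite ge_min lexx.
  have /Dy[y_0 y_1 y_2] : Num.min (v' x) (v' y') <= v' y'.
    by rewrite ge_min lexx orbT.
  split.
  - by apply: (val_ge_homoD hv (g := fun k => 3 * k)) => // i j; lia.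
  - by apply: (val_ge_homoD hv (g := fun k => 3 * k + v a)) => // i j; lia.
  - by apply: (val_ge_homoD hv (g := fun k => 3 * k + 2 * v a)) => // i j; lia.
(* The norm of [y] is [a]. *)
have v'y : v' y = v a.
  have yE' : y = 0%:A + 1%:A * y + 0%:A * y ^+ 2.
    by rewrite !scale0r scale1r mul0r mul1r add0r addr0.
  have cy : c y = (0, 1, 0) by rewrite {1}yE' cK.
  by rewrite /v' /N cy /= /cubic_norm; congr v; ring.
have y0 : y != 0.
  apply/eqP=> y0; move: yE; rewrite y0 mulr0 add0r expr0n /= => /esym/eqP.
  by rewrite scaler_eq0 oner_eq0 orbF (negbTE a0).
pose P' := [set u : L | u = 0 \/ 0 < v' u].
have nv' : normalized_valuation (ext_constants iota L) P' v'.
  case: (nv) => _ _ [t t0 vt] vc PE.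
  case: (hv') => v'M v'D; split => //.
    (* Since [v' t = 3] and [v' y = v a] are coprime, a Bezout relation yields a uniformizer
       [t ^ i * y ^ j]. *)
    have [i [j ij]] : exists i j : int, 3 * i + j * v a = 1.
      have [s va3] : exists s, v a = 3 * s + 1 \/ v a = 3 * s + 2.
        by exists (v a %/ 3)%Z; lia.
      case: va3 => ->; first by exists (- s), 1; lia.
      by exists (- (2 * s) - 1), 2; lia.
    exists ((t ^ i)%:A * y ^ j).
      by rewrite mulf_neq0 ?expfz_neq0 // scaler_eq0 oner_eq0 orbF expfz_neq0.
    rewrite v'M ?expfz_neq0 // ?v'K ?expfz_neq0 //; last first.
      by rewrite scaler_eq0 oner_eq0 orbF expfz_neq0.
    by rewrite (valuationXz hv') // (valuationXz hv) // v'y vt mulr1.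
  move=> d d0; rewrite /ext_constants /= v'K ?fmorph_eq0 // vc //.
exists P'; split.
- exact: normalized_valuation_place nv'.
- move=> _ [x Px <-]; have [_ _ _ _ PE] := nv.
  move: Px; rewrite PE => -[->|vx]; first by left; rewrite scale0r.
  have [->|x0] := eqVneq x 0; first by left; rewrite scale0r.
  by right; rewrite v'K //; lia.
- by exists v, v'; split.
Qed.

End CubicExtension.

(** * From ramification index 3 to the valuation of [a] *)

Section Converse.
Variables (K : fieldType) (L : fieldExtType K) (v : K -> int) (v' : L -> int).
Hypothesis hv : int_valuation v.
Hypothesis hv' : int_valuation v'.
Hypothesis v'K : forall x : K, x != 0 -> v' x%:A = 3%:Z * v x.

Lemma alg_neq0 (x : K) : x != 0 -> x%:A != 0 :> L.
Proof. by move=> x0; rewrite scaler_eq0 oner_eq0 orbF. Qed.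

Lemma val_ge_alg (k : int) (x : K) : val_ge v k x -> val_ge v' (3 * k) x%:A.
Proof.
case: (eqVneq x 0) => [->|x0]; first by left; rewrite scale0r.
case=> [x0'|kx]; first by rewrite x0' eqxx in x0.
by right; rewrite v'K //; lia.
Qed.

(** Nonzero terms in [t] and [t ^+ 2] have valuations congruent to 1 and 2 mod 3, so they cannot
    cancel and the sum takes one of these values. *)
Lemma val_uniformizer_span (t : L) (c1 c2 : K) : t != 0 -> v' t = 1 ->
  (c1 != 0) || (c2 != 0) ->
  c1%:A * t + c2%:A * t ^+ 2 != 0 /\
  ~~ (3 %| v' (c1%:A * t + c2%:A * t ^+ 2)%R)%Z.
Proof.
move=> t0 vt.
have v1 c : c != 0 -> v' (c%:A * t) = 3 * v c + 1.
  by move=> c0; rewrite (valuationM hv') ?alg_neq0 // v'K // vt.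
have v2 c : c != 0 -> v' (c%:A * t ^+ 2) = 3 * v c + 2.
  move=> c0; rewrite (valuationM hv') ?alg_neq0 ?expf_neq0 // v'K //.
  by rewrite (valuationX hv') // vt.
have [->|c1n] := eqVneq c1 0; have [->|c2n] //= := eqVneq c2 0 => _.
- rewrite scale0r mul0r add0r mulf_neq0 ?alg_neq0 ?expf_neq0 // v2 //.
  by split=> //; lia.
- rewrite scale0r mul0r addr0 mulf_neq0 ?alg_neq0 // v1 //.
  by split=> //; lia.
- have [|||-> vE] := val_neq_add hv' (x := c1%:A * t) (y := c2%:A * t ^+ 2).
  + by rewrite mulf_neq0 ?alg_neq0.
  + by rewrite mulf_neq0 ?alg_neq0 ?expf_neq0.
  + by rewrite v1 // v2 //; lia.
  by split=> //; case: vE => ->; rewrite ?v1 ?v2 //; lia.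
Qed.

(** A nonzero [c0] has valuation divisible by 3, so it cannot cancel the other two terms. *)
Lemma uniformizer_powers_free (t : L) : t != 0 -> v' t = 1 -> powers_free t.
Proof.
move=> t0 vt c0 c1 c2; case: (boolP ((c1 != 0) || (c2 != 0))) => c12.
  have [z0 nvz] := val_uniformizer_span t0 vt c12.
  rewrite -addrA; have [->|c0n] := eqVneq c0 0.
    by rewrite scale0r add0r => /eqP; rewrite (negbTE z0).
  have [|s0 _] := val_neq_add hv' (alg_neq0 c0n) z0.
    by rewrite v'K //; apply: contra nvz => /eqP <-; rewrite dvdz_mulr.
  by move/eqP; rewrite (negbTE s0).
move: c12; rewrite negb_or !negbK => /andP[/eqP-> /eqP->].
rewrite !scale0r !mul0r !addr0 => /eqP.
by rewrite scaler_eq0 oner_eq0 orbF => /eqP.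
Qed.

Lemma ramified_cubic_val (a : K) (y t : L) :
  (3%:R : K) != 0 -> v 3%:R = 0 -> \dim {:L} = 3%N ->
  powers_free y -> y ^+ 3 = 3%:R * y + a%:A -> t != 0 -> v' t = 1 ->
  v a < 0 /\ ~~ (3 %| v a)%Z.
Proof.
move=> n3 v3 dimL yfree yE t0 vt.
have [c cE] := powers_free_coords dimL (uniformizer_powers_free t0 vt).
move: (cE y); move: (c y) => [[c0 c1] c2] /=; rewrite -addrA.
(* If both coefficients vanished, [y] would lie in [K]. *)
case: (boolP ((c1 != 0) || (c2 != 0))) => c12; last first.
  move: c12; rewrite negb_or !negbK => /andP[/eqP-> /eqP->].
  rewrite !scale0r !mul0r !addr0 => yc0.
  have [] := yfree (- c0) 1 0; last by move=> _ /eqP; rewrite oner_eq0.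
  by rewrite yc0 scale0r mul0r addr0 scaleNr scale1r mul1r addNr.
have [] := val_uniformizer_span t0 vt c12.
move: (_ + _) => z z0 nr yz; set r := v' z in nr.
pose d := c0 ^+ 2 - 1; pose g := a - (c0 ^+ 3 - 3%:R * c0).
have AM k l : (k * l)%:A = k%:A * l%:A :> L by rewrite mulr_algl scalerA.
have A3 : 3%:R%:A = 3%:R :> L by rewrite scaler_nat.
pose T1 := (3%:R * c0)%:A * z ^+ 2; pose T2 := (3%:R * d)%:A * z.
have gE : g%:A = T1 + (T2 + z ^+ 3).
  have -> : g%:A = a%:A - (c0%:A ^+ 3 - 3%:R * c0%:A) :> L.
    rewrite /g !scalerBl (AM 3%:R) A3 !exprS !expr0 !AM. by rewrite scale1r.
  have -> : a%:A = y ^+ 3 - 3%:R * y by rewrite yE addrAC subrr add0r.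
  rewrite /T1 /T2 /d !(AM 3%:R) A3 scalerBl scale1r expr2 AM yz.
  by ring.
have g_mod n : g%:A != 0 :> L -> v' g%:A = n -> (3 %| n)%Z.
  move=> gA0 <-; rewrite v'K ?dvdz_mulr //.
  by apply: contra gA0 => /eqP->; rewrite scale0r.
(* Large enough that [c0 = 0] gives [3 * k > r] and [d = 0] gives [3 * l > 2 * r]. *)
pose N := `|r| + 1.
have [k [gk hk]] := val_lower_bound v N c0.
have [l [gl hl]] := val_lower_bound v N d.
have g3 : val_ge v 0 3%:R by right; rewrite v3.
have gz := val_ge_refl v' z; rewrite -/r in gz.
have gT1 := val_geM hv' (val_ge_alg (val_geM hv g3 gk)) (val_geX hv' 2 gz).
have gT2 := val_geM hv' (val_ge_alg (val_geM hv g3 gl)) gz.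
have gT3 := val_geX hv' 3 gz.
rewrite -/T1 in gT1; rewrite -/T2 in gT2.
(* Here [T1] would strictly dominate, as [3 * k = r] is impossible; then [g] would have valuation
   [3 * k + 2 * r], not divisible by 3. *)
have T1_small : (3 * k <= r) && (3 * k + r < 3 * l) = false.
  apply/negP=> /andP[kr krl].
  case: hk => -[c0n kE]; first by lia.
  have T10 : T1 != 0 by rewrite mulf_neq0 ?expf_neq0 ?alg_neq0 ?mulf_neq0.
  have vT1 : v' T1 = 3 * k + 2 * r.
    rewrite (valuationM hv') ?expf_neq0 ?alg_neq0 ?mulf_neq0 //.
    rewrite v'K ?mulf_neq0 // (valuationM hv) // v3 (valuationX hv') //.
    by rewrite -kE; lia.
  have [|gA0 vg] := val_dominant (y := T2 + z ^+ 3) hv' T10.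
    rewrite vT1; apply: (val_geD hv');
      [apply: val_ge_trans gT2 | apply: val_ge_trans gT3]; lia.
  by rewrite -gE in gA0 vg; have := g_mod _ gA0 vg; rewrite vT1; lia.
(* Likewise [T2] would dominate with valuation [3 * l + r]. *)
have T2_small : (3 * l <= 2 * r) && (3 * l < 3 * k + r) = false.
  apply/negP=> /andP[lr lrk].
  case: hl => -[dn lE]; first by lia.
  have T20 : T2 != 0 by rewrite mulf_neq0 ?alg_neq0 ?mulf_neq0.
  have vT2 : v' T2 = 3 * l + r.
    rewrite (valuationM hv') ?alg_neq0 ?mulf_neq0 // v'K ?mulf_neq0 //.
    by rewrite (valuationM hv) // v3 -lE; lia.
  have [|gA0 vg] := val_dominant (y := T1 + z ^+ 3) hv' T20.
    rewrite vT2; apply: (val_geD hv');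
      [apply: val_ge_trans gT1 | apply: val_ge_trans gT3]; lia.
  rewrite addrCA -gE in gA0 vg; have := g_mod _ gA0 vg; rewrite vT2; lia.
(* The remaining case [3 * l = 3 * k + r] contradicts that 3 does not divide [r]. *)
have kr : r < 3 * k by lia.
have lr : 2 * r < 3 * l by lia.
have r_neg : r < 0.
  rewrite ltNge; apply/negP => r0.
  have : val_ge v 1 1.
    have -> : 1 = c0 ^+ 2 - d :> K by rewrite /d; ring.
    apply: (val_geD hv); first by apply: val_ge_trans (val_geX hv 2 gk); lia.
    by apply: (val_geN hv); apply: val_ge_trans gl; lia.
  by case=> [/eqP|]; rewrite ?oner_eq0 // (valuation1 hv).
have [|y0 vy] := val_dominant (y := c0%:A) hv' z0.
  by rewrite -/r; apply: val_ge_trans (val_ge_alg gk); lia.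
rewrite addrC -yz in y0 vy.
have y30 : y ^+ 3 != 0 by rewrite expf_neq0.
(* As [v' y = r < 0], the term [y ^+ 3] dominates in [a = y ^+ 3 - 3 y]. *)
have [|aA0 va] := val_dominant (y := - (3%:R * y)) hv' y30.
  apply: (val_geN hv'); have := val_geM hv' (val_ge_alg g3) (val_ge_refl v' y).
  by rewrite A3; apply: val_ge_trans; rewrite (valuationX hv') // vy -/r; lia.
move: aA0 va; rewrite yE addrAC subrr add0r -yE (valuationX hv') // vy -/r.
move=> aA0.
rewrite v'K; last by apply: contra aA0 => /eqP->; rewrite scale0r.
by move=> va; lia.
Qed.

End Converse.

(** * The criterion over a function field *)

Theorem mainTheorem13 (F : finFieldType) (p : nat) (hp : p \in [pchar F])
    (hp3 : p <> 3%N)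
    (K : fieldType) (iota : {rmorphism F -> K})
    (hK : function_field iota) (hconst : full_constant_field iota)
    (L : fieldExtType K) (hL : impurely_cubic L)
    (y : L) (hy : primitive_element y)
    (a : K) (hmin : minPoly 1 y = 'X^3 - 3%:R *: 'X - (a%:A)%:P)
    (P : set K) (hP : is_place iota P)
    (v : K -> int) (hv : normalized_valuation iota P v) :
  fully_ramified iota L P <-> (v a < 0 /\ gcdz (v a) 3 = 1).
Proof.
have [dimL _] := hL.
have yE : y ^+ 3 = 3%:R * y + a%:A.
  have /rootP := root_minPoly 1 y; rewrite hmin !hornerE -addrA -opprD.
  by move/eqP; rewrite subr_eq0 => /eqP.
have yfree : powers_free y.
  apply: minPoly_powers_free; rewrite hmin -addrA size_polyDl size_polyXn //.
  rewrite -opprD size_polyN ltnS (leq_trans (size_polyD _ _)) // geq_max.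
  rewrite (leq_trans (size_scale_leq _ _)) ?size_polyX //.
  by rewrite (leq_trans (size_polyC_leq1 _)).
have gcd3 : gcdz (v a) 3 = 1 <-> ~~ (3 %| v a)%Z.
  rewrite dvdzE -prime_coprime // coprime_sym /coprime /gcdz.
  by split=> [[->]|/eqP->].
have n3 : (3%:R : F) != 0.
  rewrite -(dvdn_pcharf hp) dvdn_prime2 ?(pcharf_prime hp) //; exact/eqP.
split.
- case=> P' [_ _ [w [v' [nw nv' v'w]]]].
  (* The ramification index comes with its own valuation [w] at [P], which agrees with [v] off 0. *)
  have wv := normalized_valuation_unique nw hv.
  have [_ _ [t t0 vt] _ _] := nv'.
  rewrite gcd3; apply: (ramified_cubic_val _ _ _ _ _ dimL yfree yE t0 vt) => //.
  + exact: normalized_int_valuation hv.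
  + exact: normalized_int_valuation nv'.
  + by move=> x x0; rewrite v'w // wv.
  + by rewrite -(rmorph_nat iota) fmorph_eq0.
  + by rewrite -(rmorph_nat iota); case: hv => _ _ _ ->.
- case=> va /gcd3 nva; apply: (fully_ramified_of_val hv dimL yfree yE) => //.
  (* The value [v 0] is arbitrary, so [a = 0] is excluded separately: then [y * (y ^+ 2 - 3) = 0],
     against the independence of [1], [y], [y ^+ 2]. *)
  apply/eqP=> a0; move: yE; rewrite a0 scale0r addr0 => /eqP.
  rewrite exprSr -subr_eq0 -mulrBl mulf_eq0 => /orP[] /eqP e.
    have [] := yfree (- 3%:R) 0 1; last by move=> _ _ /eqP; rewrite oner_eq0.
    by rewrite scaleNr scaler_nat scale0r mul0r addr0 scale1r mul1r addrC.
  have [] := yfree 0 1 0; last by move=> _ /eqP; rewrite oner_eq0.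
  by rewrite !scale0r e mulr0 mul0r !addr0.
Qed.
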